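(* For every quantum channel $\mathcal{N}$ from $A$ to $B$ (finite-dimensional systems) with Choi matrix $J_{\mathcal{N}}$, $$\mathrm{cv}(\mathcal{N})=2^{-H^{\mathrm{sep}}_{\min}(A|B)_{J_{\mathcal{N}}}}.$$
   Context: All Hilbert spaces are finite-dimensional; a quantum channel from $A$ to $B$ is a CPTP map from operators on $\mathcal{H}^A$ to operators on $\mathcal{H}^B$. $\mathcal{D}(A)$ is the set of density operators on $\mathcal{H}^A$. The Choi matrix of $\mathcal{N}$ is $J_{\mathcal{N}}=\sum_{i,j=1}^{d_A}|i\rangle\langle j|\otimes\mathcal{N}(|i\rangle\langle j|)$ on $\mathcal{H}^A\otimes\mathcal{H}^B$. Communication value: for a classical channel with transition probabilities $P(y|x)$, $x\in[n]$, $y\in[n']$, put $\mathrm{cv}(\mathbf{P})=\sum_{y\in[n']}\max_{x\in[n]}P(y|x)$. For a quantum channel, $\mathrm{cv}(\mathcal{N})$ is the supremum, over all $n,n'\in\mathbb{N}$, all states $\rho_1,\dots,\rho_n\in\mathcal{D}(A)$ and all POVMs $\{\Pi_y\}_{y=1}^{n'}$ on $\mathcal{H}^B$, of $\mathrm{cv}(\mathbf{P})$ with $P(y|x)=\mathrm{Tr}[\Pi_y\mathcal{N}(\rho_x)]$. $\mathrm{SEP}(A:B)$ is the cone of operators of the form $\sum_i t_i|\alpha_i\rangle\langle\alpha_i|\otimes|\beta_i\rangle\langle\beta_i|$ with $t_i\ge0$, and $\mathrm{SEP}^*(A:B)$ is its dual cone, i.e. all Hermitian $\omega$ on $\mathcal{H}^A\otimes\mathcal{H}^B$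 with $\mathrm{Tr}[\omega\tau]\ge0$ for all $\tau\in\mathrm{SEP}(A:B)$. Write $X\leq_{\mathrm{SEP}^*}Y$ iff $Y-X\in\mathrm{SEP}^*(A:B)$. Set $D^{\mathrm{sep}}_{\max}(\mu\Vert\nu)=\min\{\lambda\in\mathbb{R}\;|\;\mu\leq_{\mathrm{SEP}^*}2^{\lambda}\nu\}$. The conditional separable min-entropy of a positive semidefinite operator $\omega^{AB}$ is $$H^{\mathrm{sep}}_{\min}(A|B)_{\omega}=-\min_{\sigma^B\in\mathcal{D}(B)}D^{\mathrm{sep}}_{\max}(\omega\Vert\mathbb{I}^A\otimes\sigma^B).$$ *)

(* Defs.v *)
From HB Require Import structures.
From mathcomp Require Import all_boot all_order all_algebra.
From mathcomp Require Import sesquilinear spectral.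
From mathcomp Require Import complex mxtens.
From mathcomp Require Import boolp classical_sets reals ereal exp.

Set Implicit Arguments.
Unset Strict Implicit.
Unset Printing Implicit Defensive.

Import Order.TTheory GRing.Theory Num.Theory.

Local Open Scope ring_scope.
Local Open Scope complex_scope.
Local Open Scope sesquilinear_scope.
Local Open Scope classical_set_scope.

(* Operators on a d-dimensional Hilbert space are matrices over R[i], kets are
   column vectors, and H^A (x) H^B is indexed through mxtens_index, the first
   factor being the most significant one.  In the order of R[i], 0 <= z means
   that z is real and nonnegative. *)

Section Operators.
Variable R : realType.
Local Notation C := R[i].

Definition ketbra d (v : 'cV[C]_d) : 'M[C]_d := v *m v ^t*.

Definition psd d (M : 'M[C]_d) : Prop :=
  M \is hermsymmx /\ forall v : 'cV[C]_d, 0 <= (v ^t* *m M *m v) 0 0.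

Definition density d (rho : 'M[C]_d) : Prop := psd rho /\ \tr rho = 1.

Definition povm d n (Pi : 'I_n -> 'M[C]_d) : Prop :=
  (forall y, psd (Pi y)) /\ \sum_y Pi y = 1%:M.

End Operators.

Section Channels.
Variables (R : realType) (dA dB : nat).
Local Notation C := R[i].
Implicit Type N : {linear 'M[C]_dA -> 'M[C]_dB}.

(* Block (i, j) of an operator on C^k (x) H^A, an operator on H^A. *)
Definition tens_block k (X : 'M[C]_(k * dA)) (i j : 'I_k) : 'M[C]_dA :=
  \matrix_(a, b) X (mxtens_index (i, a)) (mxtens_index (j, b)).

(* The map id (x) N from operators on C^k (x) H^A to those on C^k (x) H^B. *)
Definition ampliation N k (X : 'M[C]_(k * dA)) : 'M[C]_(k * dB) :=
  \sum_(i < k) \sum_(j < k) delta_mx i j *t N (tens_block X i j).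

Definition completely_positive N : Prop :=
  forall k (X : 'M[C]_(k * dA)), psd X -> psd (ampliation N X).

Definition trace_preserving N : Prop := forall X, \tr (N X) = \tr X.

Definition quantum_channel N : Prop :=
  completely_positive N /\ trace_preserving N.

Definition choi N : 'M[C]_(dA * dB) :=
  \sum_(i < dA) \sum_(j < dA) delta_mx i j *t N (delta_mx i j).

End Channels.

Section CommunicationValue.
Variable R : realType.
Local Notation C := R[i].

(* P x y stands for P(y|x) >= 0, so seeding the maximum with 0 does not change
   it as soon as 0 < n. *)
Definition classical_cv n n' (P : 'I_n -> 'I_n' -> R) : R :=
  \sum_(y < n') \big[Num.max/0]_(x < n) P x y.

Definition induced_channel dA dB (N : {linear 'M[C]_dA -> 'M[C]_dB}) n n'
    (rho : 'I_n -> 'M[C]_dA) (Pi : 'I_n' -> 'M[C]_dB) : 'I_n -> 'I_n' -> R :=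
  fun x y => complex.Re (\tr (Pi y *m N (rho x))).

Definition cv dA dB (N : {linear 'M[C]_dA -> 'M[C]_dB}) : \bar R :=
  ereal_sup [set c | exists n n' (rho : 'I_n -> 'M[C]_dA)
      (Pi : 'I_n' -> 'M[C]_dB),
    [/\ (0 < n)%N, (forall x, density (rho x)), povm Pi
      & c = (classical_cv (induced_channel N rho Pi))%:E]].

End CommunicationValue.

Section SeparableMinEntropy.
Variables (R : realType) (dA dB : nat).
Local Notation C := R[i].
Implicit Types (omega tau mu nu : 'M[C]_(dA * dB)) (sigma : 'M[C]_dB).

Definition SEP tau : Prop :=
  exists k (t : 'I_k -> R) (alpha : 'I_k -> 'cV[C]_dA)
      (beta : 'I_k -> 'cV[C]_dB),
    (forall i, 0 <= t i) /\
    tau = \sum_(i < k) (t i)%:C *: (ketbra (alpha i) *t ketbra (beta i)).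

Definition SEP_dual omega : Prop :=
  omega \is hermsymmx /\ forall tau, SEP tau -> 0 <= \tr (omega *m tau).

Definition le_SEP_dual mu nu : Prop := SEP_dual (nu - mu).

(* +oo when no lambda is feasible. *)
Definition Dsep_max mu nu : \bar R :=
  ereal_inf [set lambda%:E | lambda in
    [set lambda : R | le_SEP_dual mu ((2 `^ lambda)%:C *: nu)]].

Definition Hsep_min omega : \bar R :=
  (- ereal_inf [set Dsep_max omega ((1%:M : 'M[C]_dA) *t sigma)
                | sigma in [set sigma : 'M[C]_dB | density sigma]])%E.

(* Hsep_min is defined with infima; this says that both are minima: some
   feasible pair (sigma, lambda) has lambda = - Hsep_min. *)
Definition Hsep_min_attained omega : Prop :=
  exists sigma (lambda : R),
    [/\ density sigma,
        le_SEP_dual omega ((2 `^ lambda)%:C *: ((1%:M : 'M[C]_dA) *t sigma))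
      & Hsep_min omega = (- lambda%:E)%E].

End SeparableMinEntropy.

Definition pow2e (R : realType) (x : \bar R) : \bar R :=
  match x with
  | r%:E => (2 `^ r)%:E
  | +oo => +oo
  | -oo => 0
  end%E.

(* Main.v *)
Require Import Defs.
From mathcomp Require Import all_boot all_order all_algebra.
From mathcomp Require Import complex reals ereal.
From mathcomp Require Import sesquilinear spectral mxtens.
From mathcomp Require Import boolp classical_sets exp.
From mathcomp Require Import topology normedtype sequences ring lra.

(** The two quantities are the values of a conic program and its dual.  Writing
    [2^lambda sigma = Z], the pair [(lambda, sigma)] is feasible for the
    separable min-entropy iff [Z - N rho] is positive semidefinite for every
    state [rho], so the dual value is the least trace of such a [Z]; weak
    duality is immediate.  For strong duality take states and a POVM whose
    value [sum_y tr (Pi_y N(rho_y))] is within [e^2] of the supremum, and let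
    [H] be the Hermitian part of [sum_y Pi_y N(rho_y)].  For a unit vector with
    projector [P], the POVM [(1 - e P) Pi_y (1 - e P)] completed by the outcome
    [e (2 - e) P] with guess [r] is still a competitor, and comparing values to
    first order in [e] gives [<P, N r> <= <P, H> + e].  Hence [H + e 1] is
    feasible with trace at most [cv + e d_B], and a cluster point as [e -> 0]
    is an optimal [Z]. *)

Set Implicit Arguments.
Unset Strict Implicit.
Unset Printing Implicit Defensive.

Import Order.TTheory GRing.Theory Num.Theory.
Import numFieldNormedType.Exports.

Local Open Scope ring_scope.
Local Open Scope complex_scope.
Local Open Scope sesquilinear_scope.

(** * Real parts of complex numbers *)

Section Re.

Variable R : realType.
Local Notation C := R[i].

Lemma complex_ReD (x y : C) : complex.Re (x + y) = complex.Re x + complex.Re y.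
Proof. by case: x y => [a b] [c d]. Qed.

Lemma complex_ReN (x : C) : complex.Re (- x) = - complex.Re x.
Proof. by case: x. Qed.

Lemma complex_ReMl (r : R) (x : C) : complex.Re (r%:C * x) = r * complex.Re x.
Proof. by case: x => a b /=; rewrite mul0r subr0. Qed.

Lemma complex_Re_conj (x : C) : complex.Re (Num.conj x) = complex.Re x.
Proof. by case: x. Qed.

Lemma conj_real_complex (r : R) : Num.conj (r%:C) = r%:C :> C.
Proof. exact: conjc_real. Qed.

Lemma complex_Re_ge0 (z : C) : 0 <= z -> 0 <= complex.Re z.
Proof. by rewrite lecE => /andP[]. Qed.
End Re.

(** * Adjoints and Hermitian matrices *)

Section Adjoint.

Variable C : numClosedFieldType.

Lemma adjmxM m n p (A : 'M[C]_(m, n)) (B : 'M[C]_(n, p)) :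
  (A *m B)^t* = B^t* *m A^t*.
Proof. by rewrite trmx_mul map_mxM. Qed.

Lemma adjmxK m n (A : 'M[C]_(m, n)) : (A^t*)^t* = A.
Proof. by apply/matrixP=> i j; rewrite !mxE conjCK. Qed.

Lemma adjmxD m n (A B : 'M[C]_(m, n)) : (A + B)^t* = A^t* + B^t*.
Proof. by rewrite linearD /= map_mxD. Qed.

Lemma adjmxB m n (A B : 'M[C]_(m, n)) : (A - B)^t* = A^t* - B^t*.
Proof. by rewrite linearB /= map_mxB. Qed.

Lemma adjmxZ m n a (A : 'M[C]_(m, n)) : (a *: A)^t* = Num.conj a *: A^t*.
Proof. by rewrite linearZ /= map_mxZ. Qed.

Lemma adjmx1 n : (1%:M : 'M[C]_n)^t* = 1%:M.
Proof. by rewrite trmx1 map_mx1. Qed.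

Lemma adjmx_sum m n (I : finType) (A : I -> 'M[C]_(m, n)) :
  (\sum_i A i)^t* = \sum_i (A i)^t*.
Proof.
apply/matrixP=> i j; rewrite !mxE !summxE rmorph_sum.
by apply: eq_bigr=> k _; rewrite !mxE.
Qed.

Lemma trace_adjmx n (A : 'M[C]_n) : \tr (A^t*) = Num.conj (\tr A).
Proof. by rewrite /mxtrace rmorph_sum; apply: eq_bigr=> k _; rewrite !mxE. Qed.

Lemma hermsymmxP n (M : 'M[C]_n) : reflect (M^t* = M) (M \is hermsymmx).
Proof.
by apply: (iffP (is_hermitianmxP _ _ _)); rewrite expr0 scale1r => /esym.
Qed.
End Adjoint.

Lemma trace_tens (K : comPzRingType) m n (A : 'M[K]_m) (B : 'M[K]_n) :
  \tr (A *t B) = \tr A * \tr B.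
Proof.
rewrite /mxtrace mulr_sum; apply: eq_bigr => i _.
by rewrite mxE.
Qed.

(** * Positive semidefinite operators and the real trace pairing *)

Section Psd.

Variable R : realType.
Local Notation C := R[i].

Lemma trace_ketbra d (M : 'M[C]_d) v :
  \tr (M *m ketbra v) = (v^t* *m M *m v) 0 0.
Proof. by rewrite /ketbra mulmxA mxtrace_mulC mulmxA /mxtrace big_ord1. Qed.

Lemma adjmx_ketbra d (v : 'cV[C]_d) : (ketbra v)^t* = ketbra v.
Proof. by rewrite /ketbra adjmxM adjmxK. Qed.

Definition retr d (M : 'M[C]_d) : R := complex.Re (\tr M).

Lemma retrD d (A B : 'M[C]_d) : retr (A + B) = retr A + retr B.
Proof. by rewrite /retr mxtraceD complex_ReD. Qed.

Lemma retrB d (A B : 'M[C]_d) : retr (A - B) = retr A - retr B.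
Proof. by rewrite /retr linearB /= complex_ReD complex_ReN. Qed.

Lemma retrZ d (r : R) (A : 'M[C]_d) : retr (r%:C *: A) = r * retr A.
Proof. by rewrite /retr mxtraceZ complex_ReMl. Qed.

Lemma retr_sum d I (r : seq I) (P : pred I) (A : I -> 'M[C]_d) :
  retr (\sum_(i <- r | P i) A i) = \sum_(i <- r | P i) retr (A i).
Proof. by apply: (big_morph _ (@retrD d)); rewrite /retr mxtrace0. Qed.

Lemma retr_adjmx d (A : 'M[C]_d) : retr (A^t*) = retr A.
Proof. by rewrite /retr trace_adjmx complex_Re_conj. Qed.

Lemma retrC m n (A : 'M[C]_(m, n)) (B : 'M[C]_(n, m)) :
  retr (A *m B) = retr (B *m A).
Proof. by rewrite /retr mxtrace_mulC. Qed.

Lemma trace_ketbra_real d (M : 'M[C]_d) v : M^t* = M ->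
  \tr (M *m ketbra v) = (retr (M *m ketbra v))%:C.
Proof.
move=> hM.
have : Num.conj (\tr (M *m ketbra v)) = \tr (M *m ketbra v).
  by rewrite -trace_adjmx adjmxM hM adjmx_ketbra mxtrace_mulC.
rewrite /retr; case: (\tr _) => a b /= [] hb.
by apply/eqP; rewrite eq_complex /= eqxx; apply/eqP; lra.
Qed.

(** A Hermitian operator has real quadratic forms, so positivity can be tested on the real number
    [retr]. *)
Lemma psdP d (M : 'M[C]_d) :
  psd M <-> M^t* = M /\ forall v, 0 <= retr (M *m ketbra v).
Proof.
split=> [[/hermsymmxP hM hv]|[hM hv]]; split=> //.
- by move=> v; apply: complex_Re_ge0; rewrite trace_ketbra.
- exact/hermsymmxP.
- by move=> v; rewrite -trace_ketbra trace_ketbra_real // ler0c.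
Qed.

Lemma psd_conj m n (A : 'M[C]_m) (B : 'M[C]_(m, n)) :
  psd A -> psd (B^t* *m A *m B).
Proof.
move=> [/hermsymmxP hA hv]; split.
  by apply/hermsymmxP; rewrite !adjmxM adjmxK hA mulmxA.
by move=> v; have := hv (B *m v); rewrite adjmxM !mulmxA.
Qed.

Lemma psd1 n : psd (1%:M : 'M[C]_n).
Proof.
split; first by apply/hermsymmxP; rewrite adjmx1.
move=> v; rewrite mulmx1 mxE; apply: sumr_ge0 => i _; rewrite !mxE mulrC.
exact: mulcJ_ge0.
Qed.

Lemma psd_ketbra n (v : 'cV[C]_n) : psd (ketbra v).
Proof. by have := psd_conj (v^t*) (psd1 1); rewrite adjmxK mulmx1. Qed.

Lemma psdD n (A B : 'M[C]_n) : psd A -> psd B -> psd (A + B).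
Proof.
move=> /psdP[hA vA] /psdP[hB vB]; apply/psdP; split.
  by rewrite adjmxD hA hB.
by move=> v; rewrite mulmxDl retrD addr_ge0.
Qed.

Lemma psdZ n (r : R) (A : 'M[C]_n) : 0 <= r -> psd A -> psd (r%:C *: A).
Proof.
move=> r0 /psdP[hA vA]; apply/psdP; split.
  by rewrite adjmxZ hA conj_real_complex.
by move=> v; rewrite -scalemxAl retrZ mulr_ge0.
Qed.

(** Spectral theorem: the vectors are orthonormal eigenvectors, each scaled by the square root of
    its eigenvalue. *)
Lemma psd_sum_ketbra d (M : 'M[C]_d) : psd M ->
  exists v : 'I_d -> 'cV[C]_d, M = \sum_i ketbra (v i).
Proof.
move=> [hM hv]; have /hermitian_normalmx /orthomx_spectralP := hM.
set P := spectralmx M; set D := spectral_diag M => M_eq.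
have P_unit : P \is unitarymx by exact: spectral_unitarymx.
have Pinv : invmx P = P^t* by rewrite invmx_unitary.
have PP : P *m P^t* = 1%:M by apply/unitarymxP.
(* An eigenvalue is the quadratic form of [M] at the corresponding eigenvector, a column of
   [P^t*]. *)
have D_ge0 i : 0 <= D 0 i.
  have := hv (P^t* *m delta_mx i 0).
  rewrite M_eq Pinv adjmxM adjmxK !mulmxA.
  rewrite -(mulmxA _ P) PP mulmx1 -(mulmxA _ P) PP mulmx1.
  by rewrite trmx_delta map_delta_mx -rowE -colE !mxE eqxx mulr1n.
exists (fun i => sqrtc (D 0 i) *: (P^t* *m delta_mx i 0)).
rewrite M_eq Pinv.
transitivity (\sum_i (D 0 i) *: (P^t* *m delta_mx i i *m P)).
  rewrite diag_mx_sum_delta mulmx_sumr mulmx_suml.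
  by apply: eq_bigr => i _; rewrite -scalemxAr -scalemxAl.
apply: eq_bigr => i _.
rewrite /ketbra adjmxZ adjmxM adjmxK -!scalemxAl -!scalemxAr scalerA.
rewrite -sqr_normc ger0_norm ?sqrtc_ge0 // sqr_sqrtc; congr (_ *: _).
rewrite trmx_delta map_delta_mx -!mulmxA; congr (_ *m _).
by rewrite mulmxA mul_delta_mx.
Qed.

Lemma retr_psd_ge0 d (A B : 'M[C]_d) : psd A -> psd B -> 0 <= retr (A *m B).
Proof.
move=> /psdP[_ hA] /psd_sum_ketbra[v ->].
by rewrite mulmx_sumr retr_sum sumr_ge0.
Qed.
End Psd.

Lemma trace_sum (K : pzSemiRingType) n I (r : seq I) (P : pred I)
    (A : I -> 'M[K]_n) :
  \tr (\sum_(i <- r | P i) A i) = \sum_(i <- r | P i) \tr (A i).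
Proof. by apply: (big_morph _ (@mxtraceD K n)); rewrite mxtrace0. Qed.

(** * The Choi matrix and positivity of channels *)

Section Channel.

Variables (R : realType) (dA dB : nat).
Local Notation C := R[i].

Variable N : {linear 'M[C]_dA -> 'M[C]_dB}.

Lemma ketbra_tens (a : 'cV[C]_dA) (b : 'cV[C]_dB) :
  ketbra a *t ketbra b = ketbra (a *t b : 'cV[C]_(dA * dB)).
Proof.
transitivity ((a *t b) *m (a *t b)^t*); last by [].
by rewrite trmx_tens map_mxT tensmx_mul.
Qed.

Lemma choiE i j k l :
  choi N (mxtens_index (i, k)) (mxtens_index (j, l)) = N (delta_mx i j) k l.
Proof.
rewrite /choi summxE (bigD1 i) //= summxE (bigD1 j) //= big1 ?addr0 => [|j' nj].
  rewrite big1 ?addr0 => [|i' ni]; first by rewrite tensmxE mxE !eqxx mul1r.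
  rewrite summxE big1 // => j' _.
  by rewrite tensmxE mxE eq_sym (negPf ni) mul0r.
by rewrite tensmxE mxE (eq_sym j) (negPf nj) andbF mul0r.
Qed.

(** The Choi matrix is the ampliation, with [k := dA], of the dyad of the unnormalised maximally
    entangled vector [om], whose blocks are the matrix units. *)
Lemma psd_choi : completely_positive N -> psd (choi N).
Proof.
pose om : 'cV[C]_(dA * dA) :=
  \col_k ((mxtens_unindex k).1 == (mxtens_unindex k).2)%:R.
move=> /(_ dA (ketbra om) (psd_ketbra om)).
congr psd; rewrite /ampliation /choi.
apply: eq_bigr => i _; apply: eq_bigr => j _; congr (_ *t N _).
apply/matrixP => a b; rewrite !mxE big_ord1 !mxE !mxtens_indexK /= conjC_nat.
by rewrite -natrM mulnb (eq_sym a) (eq_sym b).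
Qed.

Lemma channel_sum X : N X = \sum_i \sum_j X i j *: N (delta_mx i j).
Proof.
rewrite {1}[X]matrix_sum_delta linear_sum; apply: eq_bigr => i _.
by rewrite linear_sum; apply: eq_bigr => j _; rewrite linearZ.
Qed.

(** Choi-Jamiolkowski correspondence on product vectors. The conjugate arises because pairing with
    [delta_mx i j] reads entry [(j, i)] of [ketbra a], that is, its transpose. *)
Lemma trace_choi_ketbra (a : 'cV[C]_dA) (b : 'cV[C]_dB) :
  \tr (choi N *m (ketbra a *t ketbra b)) =
  \tr (N (ketbra (map_mx Num.conj a)) *m ketbra b).
Proof.
rewrite channel_sum /choi !mulmx_suml !trace_sum; apply: eq_bigr => i _.
rewrite !mulmx_suml !trace_sum; apply: eq_bigr => j _.
rewrite tensmx_mul trace_tens -scalemxAl mxtraceZ; congr (_ * _).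
rewrite -(mul_delta_mx (0 : 'I_1)) -mulmxA mxtrace_mulC -rowE -colE.
by rewrite /mxtrace big_ord1 !mxE !big_ord1 !mxE conjCK mulrC.
Qed.

(** On matrix units this is the Hermiticity of the Choi matrix, read entry by entry; linearity does
    the rest. *)
Lemma channel_adjmx : completely_positive N -> forall X, N (X^t*) = (N X)^t*.
Proof.
move=> /psd_choi/psdP[hJ _] X; rewrite !channel_sum adjmx_sum exchange_big /=.
apply: eq_bigr => i _; rewrite adjmx_sum; apply: eq_bigr => j _.
rewrite adjmxZ !mxE; congr (_ *: _); apply/matrixP => k l.
by rewrite -choiE -hJ !mxE choiE.
Qed.

(** Positivity of the Choi matrix is tested on the product of the conjugate of [v] with [w], so that
    the two conjugations cancel. *)
Lemma psd_channel_ketbra v : completely_positive N -> psd (N (ketbra v)).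
Proof.
move=> cpN; apply/psdP; split; first by rewrite -channel_adjmx // adjmx_ketbra.
move=> w; have /psdP[_ /(_ (map_mx Num.conj v *t w : 'cV__))] := psd_choi cpN.
rewrite -ketbra_tens /retr trace_choi_ketbra.
suff -> : map_mx Num.conj (map_mx Num.conj v) = v by [].
by apply/matrixP => i j; rewrite !mxE conjCK.
Qed.

Lemma psd_sum n (I : finType) (A : I -> 'M[C]_n) :
  (forall i, psd (A i)) -> psd (\sum_i A i).
Proof.
move=> hA; elim/big_rec: _ => [|i B _ pB]; last exact: (psdD (hA i) pB).
have := psdZ (lexx 0) (psd1 R n).
by rewrite scale0r.
Qed.

Lemma psd_channel X : completely_positive N -> psd X -> psd (N X).
Proof.
move=> cpN /psd_sum_ketbra[v ->]; rewrite linear_sum; apply: psd_sum => i.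
exact: psd_channel_ketbra.
Qed.

Lemma density_channel X : quantum_channel N -> density X -> density (N X).
Proof. by move=> [cpN tpN] [pX tX]; split; [exact: psd_channel|rewrite tpN]. Qed.
End Channel.

(** * Unit vectors, pure states and bounds on states *)

Section Unit.

Variable R : realType.
Local Notation C := R[i].

Lemma ketbraZ d (c : C) (v : 'cV[C]_d) :
  ketbra (c *: v) = (c * Num.conj c) *: ketbra v.
Proof. by rewrite /ketbra adjmxZ -scalemxAl -scalemxAr scalerA. Qed.

Lemma ketbra_conj d (v : 'cV[C]_d) : ketbra (map_mx Num.conj v) = (ketbra v)^T.
Proof. by apply/matrixP => i j; rewrite !mxE !big_ord1 !mxE conjCK mulrC. Qed.

Lemma trace_ketbra_eq0 d (v : 'cV[C]_d) : \tr (ketbra v) = 0 -> v = 0.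
Proof.
move=> /eqP; rewrite /mxtrace psumr_eq0 => [/allP h|i _]; last first.
  by rewrite mxE big_ord1 !mxE -sqr_normc exprn_ge0.
apply/matrixP => i j; rewrite ord1 mxE; have := h i (mem_index_enum i).
by rewrite mxE big_ord1 !mxE -sqr_normc expf_eq0 /= normr_eq0 => /eqP.
Qed.

Lemma ketbra_unit d (v : 'cV[C]_d) : (0 < d)%N ->
  exists u (s : R),
    [/\ \tr (ketbra u) = 1, 0 <= s & ketbra v = s%:C *: ketbra u].
Proof.
move=> d0; have sE : \tr (ketbra v) = (retr (ketbra v))%:C.
  by have := trace_ketbra_real v (@adjmx1 C d); rewrite mul1mx.
have s0 : 0 <= retr (ketbra v).
  by have /psdP[_ /(_ v)] := psd1 R d; rewrite mul1mx.
move: (retr (ketbra v)) sE s0 => s sE s0.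
have [s_eq0|s_neq0] := eqVneq s 0.
  (* A zero vector has no direction: the first basis vector is used with weight 0. *)
  exists (delta_mx (Ordinal d0) 0), 0; split => //.
    rewrite /ketbra mxtrace_mulC trmx_delta map_delta_mx mul_delta_mx.
    by rewrite /mxtrace big_ord1 mxE !eqxx.
  by rewrite scale0r (trace_ketbra_eq0 (etrans sE _)) ?s_eq0 // /ketbra mul0mx.
exists ((Num.sqrt s)^-1%:C *: v), s.
have cc : (Num.sqrt s)^-1%:C * Num.conj ((Num.sqrt s)^-1%:C) = (s^-1)%:C :> C.
  by rewrite conj_real_complex -rmorphM -invfM -expr2 sqr_sqrtr.
rewrite ketbraZ cc; split => //.
  by rewrite mxtraceZ sE -rmorphM mulVf.
by rewrite scalerA -rmorphM mulfV // scale1r.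
Qed.

Lemma psd_of_unit d (M : 'M[C]_d) : (0 < d)%N -> M^t* = M ->
  (forall v, \tr (ketbra v) = 1 -> 0 <= retr (M *m ketbra v)) -> psd M.
Proof.
move=> d0 hM hv; apply/psdP; split => // v.
have [u [s [u1 s0 ->]]] := ketbra_unit v d0.
by rewrite -scalemxAr retrZ mulr_ge0 ?hv.
Qed.

Lemma ketbra_idem d (v : 'cV[C]_d) : \tr (ketbra v) = 1 ->
  ketbra v *m ketbra v = ketbra v.
Proof.
rewrite -{1}[ketbra v]mul1mx trace_ketbra mulmx1 => v1.
rewrite {1 2}/ketbra mulmxA -(mulmxA v).
have -> : v^t* *m v = 1%:M.
  by apply/matrixP => i j; rewrite !ord1 v1 mxE.
by rewrite mulmx1.
Qed.

Lemma density_ketbra d (v : 'cV[C]_d) :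
  \tr (ketbra v) = 1 -> density (ketbra v).
Proof. by move=> v1; split=> //; exact: psd_ketbra. Qed.

Lemma density_exists d : (0 < d)%N -> exists rho : 'M[C]_d, density rho.
Proof.
move=> d0; have [u [_ [u1 _ _]]] := ketbra_unit 0 d0.
by exists (ketbra u); apply: density_ketbra.
Qed.

Lemma density_unit_le1 d (rho : 'M[C]_d) v :
  density rho -> \tr (ketbra v) = 1 ->
  retr (rho *m ketbra v) <= 1.
Proof.
move=> [prho trho] v1.
have adjQ : (1%:M - ketbra v)^t* = 1%:M - ketbra v.
  by rewrite adjmxB adjmx1 adjmx_ketbra.
have : psd (1%:M - ketbra v).
  have := psd_conj (1%:M - ketbra v) (psd1 R d).
  rewrite adjQ mulmx1.
  suff -> : (1%:M - ketbra v) *m (1%:M - ketbra v) = 1%:M - ketbra v by [].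
  by rewrite mulmxBl mul1mx mulmxBr mulmx1 (ketbra_idem v1) subrr subr0.
move=> /(retr_psd_ge0 prho).
by rewrite mulmxBr mulmx1 retrB {1}/retr trho subr_ge0.
Qed.

Lemma density_le1 d (rho : 'M[C]_d) :
  (0 < d)%N -> density rho -> psd (1%:M - rho).
Proof.
move=> d0 hrho; have [/psdP[hr _] _] := hrho.
apply: psd_of_unit => // [|v v1]; first by rewrite adjmxB adjmx1 hr.
by rewrite mulmxBl mul1mx retrB {1}/retr v1 subr_ge0 density_unit_le1.
Qed.

(** In a dyad the product of two moduli is at most the larger of their squares, and each square is
    one term of the trace. This turns a trace bound into the entrywise bounds needed for
    compactness. *)
Lemma norm_psd_entry_le_trace d (M : 'M[C]_d) i j : psd M -> `|M i j| <= \tr M.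
Proof.
move=> /psd_sum_ketbra[v ->]; rewrite trace_sum summxE.
apply: le_trans (ler_norm_sum _ _ _) _; apply: ler_sum => k _.
have tE : \tr (ketbra (v k)) = \sum_l `|v k l 0| ^+ 2.
  by apply: eq_bigr => l _; rewrite mxE big_ord1 !mxE -sqr_normc.
have le_t l : `|v k l 0| ^+ 2 <= \tr (ketbra (v k)).
  by rewrite tE (bigD1 l) //= lerDl sumr_ge0 // => l' _; rewrite exprn_ge0.
rewrite mxE big_ord1 !mxE normrM norm_conjC.
have /orP[le_ij|le_ji] :=
  real_leVge (normr_real (v k i 0)) (normr_real (v k j 0)).
  by apply: le_trans (le_t j); rewrite expr2 ler_wpM2r.
by apply: le_trans (le_t i); rewrite expr2 ler_wpM2l.
Qed.
End Unit.

Lemma subr_subrr (V : zmodType) (a b c d : V) : a - b - (c - d) = a - b - c + d.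
Proof. by rewrite opprB addrCA addrC. Qed.

(** * Weak duality and perturbation of near-optimal strategies *)

Section Duality.

Variables (R : realType) (dA dB : nat).
Local Notation C := R[i].
Hypotheses (hA : (0 < dA)%N) (hB : (0 < dB)%N).

Variable N : {linear 'M[C]_dA -> 'M[C]_dB}.
Hypothesis hN : quantum_channel N.

Definition dominates (Z : 'M[C]_dB) :=
  forall rho, density rho -> psd (Z - N rho).

(** Value of a strategy with one state per outcome, which replaces the maximum over inputs. *)
Definition guess n (rho : 'I_n -> 'M[C]_dA) (Pi : 'I_n -> 'M[C]_dB) : R :=
  \sum_y retr (Pi y *m N (rho y)).

Lemma dominates_psd Z : dominates Z -> psd Z.
Proof.
move=> hZ; have [rho hrho] := density_exists R hA.
have [cp _] := hN; have [prho _] := hrho.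
by rewrite -[Z](subrK (N rho)); apply: psdD (hZ _ hrho) (psd_channel cp prho).
Qed.

(** Weak duality: outcome [y] contributes at most [retr (Pi y *m Z)], and these add up to [retr Z]
    by completeness of the POVM. Positivity of [Z] takes care of the seed 0 of the maximum. *)
Lemma cv_le_dominates Z : dominates Z -> (cv N <= (retr Z)%:E)%E.
Proof.
move=> hZ; apply: ge_ereal_sup => _ [n [n' [rho [Pi [n0 hrho [hPi sPi] ->]]]]].
rewrite lee_fin /classical_cv.
have -> : retr Z = \sum_y retr (Pi y *m Z).
  by rewrite -retr_sum -mulmx_suml sPi mul1mx.
apply: ler_sum => y _; apply: bigmax_le => [|x _].
  exact: retr_psd_ge0 (hPi y) (dominates_psd hZ).
rewrite -subr_ge0 -[X in _ - X]/(retr (Pi y *m N (rho x))) -retrB -mulmxBr.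
exact: retr_psd_ge0 (hPi y) (hZ _ (hrho x)).
Qed.

Lemma povm_gt0 n (Pi : 'I_n -> 'M[C]_dB) : povm Pi -> (0 < n)%N.
Proof.
case: n Pi => // Pi [_ /(congr1 mxtrace) /esym/eqP].
by rewrite big_ord0 mxtrace0 mxtrace1 pnatr_eq0 eqn0Ngt hB.
Qed.

Lemma guess_le_cv n (rho : 'I_n -> 'M[C]_dA) Pi :
  (forall y, density (rho y)) -> povm Pi -> ((guess rho Pi)%:E <= cv N)%E.
Proof.
move=> hrho hPi; have n0 := povm_gt0 hPi; apply: le_ereal_sup_tmp.
exists (classical_cv (induced_channel N rho Pi))%:E.
  by exists n, n, rho, Pi.
rewrite lee_fin; apply: ler_sum => y _.
exact: (le_bigmax 0 (induced_channel N rho Pi ^~ y) y).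
Qed.

Lemma classical_cv_guess n n' (rho : 'I_n -> 'M[C]_dA)
    (Pi : 'I_n' -> 'M[C]_dB) :
  (0 < n)%N -> (forall x, density (rho x)) -> povm Pi ->
  exists rho', (forall y, density (rho' y)) /\
    classical_cv (induced_channel N rho Pi) = guess rho' Pi.
Proof.
move=> n0 hrho [hPi _]; have [cp _] := hN.
have hex y : exists x, \big[Num.max/0]_(x < n) induced_channel N rho Pi x y =
    induced_channel N rho Pi x y.
  have [||x _ ->] := @eq_bigmax _ _ _ 0 (Ordinal n0) predT
    (induced_channel N rho Pi ^~ y); last by exists x.
    by [].
  (* Nonnegative probabilities ensure that the maximum seeded with 0 is attained at some input. *)
  move=> x _; apply: (retr_psd_ge0 (hPi y)).
  by apply: psd_channel => //; case: (hrho x).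
have [f hf] := boolp.choice hex.
exists (rho \o f); split=> [y|]; first exact: hrho.
by apply: eq_bigr => y _; rewrite hf.
Qed.

(* The perturbation of Barnett and Croke: compress every outcome by [1 - e P]
   and give the weight thus freed to a new outcome, of index [ord0]. *)
Definition perturbed_povm n (Pi : 'I_n -> 'M[C]_dB) (e : R) (P : 'M[C]_dB)
    (y : 'I_n.+1) : 'M[C]_dB :=
  if unlift ord0 y is Some z
  then (1%:M - e%:C *: P) *m Pi z *m (1%:M - e%:C *: P)
  else (e * (2 - e))%:C *: P.

Lemma adjmx_compress e (v : 'cV[C]_dB) :
  (1%:M - e%:C *: ketbra v)^t* = 1%:M - e%:C *: ketbra v.
Proof. by rewrite adjmxB adjmx1 adjmxZ conj_real_complex adjmx_ketbra. Qed.

(** For a projector [P], the square of [1 - e P] is [1 - e (2 - e) P], so the new outcome restores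
    exactly what the compression removes. *)
Lemma povm_perturbed n (Pi : 'I_n -> 'M[C]_dB) e v :
  0 <= e <= 1 -> \tr (ketbra v) = 1 -> povm Pi ->
  povm (perturbed_povm Pi e (ketbra v)).
Proof.
move=> /andP[e0 e1] v1 [hPi sPi]; split=> [y|].
  rewrite /perturbed_povm; case: unlift => [z|].
    have := psd_conj (1%:M - e%:C *: ketbra v) (hPi z).
    by rewrite adjmx_compress.
  apply: psdZ (psd_ketbra v); apply: mulr_ge0 => //; lra.
rewrite big_ord_recl /perturbed_povm unlift_none.
under eq_bigr => y _ do rewrite liftK.
rewrite -mulmx_suml -mulmx_sumr sPi mulmx1.
rewrite mulmxBl mul1mx mulmxBr mulmx1 -!scalemxAl -scalemxAr (ketbra_idem v1).
move: (ketbra v) => P; rewrite rmorphM rmorphB /=.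
have -> : 2%:C = 2 :> C by rewrite rmorph_nat.
by move: (e%:C) => c; apply/matrixP => i j; rewrite !mxE; ring.
Qed.

(** Expand in [e]: the two first-order terms have the same real trace, by adjunction and cyclicity,
    and the second-order term is nonnegative and is dropped. *)
Lemma retr_compress (S M : 'M[C]_dB) e v : psd S -> psd M ->
  retr (S *m M) - e * 2 * retr (S *m M *m ketbra v) <=
  retr ((1%:M - e%:C *: ketbra v) *m S *m (1%:M - e%:C *: ketbra v) *m M).
Proof.
move=> pS pM; have [[hS _] [hM _]] := (iffLR (psdP S) pS, iffLR (psdP M) pM).
move: (ketbra v) (adjmx_ketbra v) => P hP.
have -> : (1%:M - e%:C *: P) *m S *m (1%:M - e%:C *: P) *m M =
  S *m M - e%:C *: (P *m (S *m M)) - e%:C *: (S *m P *m M)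
   + (e ^+ 2)%:C *: (P *m S *m P *m M).
  rewrite mulmxBl mul1mx mulmxBr mulmx1 !mulmxBl.
  rewrite -!scalemxAl -!scalemxAr -!scalemxAl.
  rewrite !mulmxA scalerA expr2 rmorphM /=.
  exact: subr_subrr.
rewrite retrD !retrB !retrZ (retrC P).
have -> : retr (S *m P *m M) = retr (S *m M *m P).
  by rewrite -retr_adjmx !adjmxM hS hM hP mulmxA [LHS]retrC mulmxA.
have p4 : 0 <= retr (P *m S *m P *m M).
  by apply: (retr_psd_ge0 _ pM); rewrite -{1}hP; apply: psd_conj.
have := mulr_ge0 (sqr_ge0 e) p4; lra.
Qed.

Lemma near_optimal_dominates (F e : R) n (rho : 'I_n -> 'M[C]_dA) Pi :
  (forall n (rho : 'I_n -> 'M[C]_dA) Pi,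
     (forall y, density (rho y)) -> povm Pi -> guess rho Pi <= F) ->
  0 < e <= 1 -> (forall y, density (rho y)) -> povm Pi -> 
  F - e ^+ 2 < guess rho Pi ->
  exists Z, dominates Z /\ retr Z <= F + e * dB%:R.
Proof.
move=> hF /andP[e0 e1] hrho hPi near; have [cp _] := hN; have [pPi _] := hPi.
(* [K] need not be Hermitian away from the optimum; its Hermitian part has the same real pairing
   with every dyad. *)
pose K := \sum_y Pi y *m N (rho y).
have half2 (x : R) : 2^-1 * (x + x) = x by lra.
have [H [hH retrH rH]] :
  exists H : 'M[C]_dB, [/\ H^t* = H, retr H = guess rho Pi &
    forall v, retr (H *m ketbra v) = retr (K *m ketbra v)].
  exists ((2^-1)%:C *: (K + K^t*)); split=> [||v].
  - by rewrite adjmxZ conj_real_complex adjmxD adjmxK addrC.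
  - by rewrite retrZ retrD retr_adjmx half2 retr_sum.
  rewrite -scalemxAl retrZ mulmxDl retrD -[X in _ + X]retr_adjmx.
  by rewrite adjmxM adjmxK adjmx_ketbra (retrC (ketbra v)) half2.
exists (H + e%:C *: 1%:M); split; last first.
  rewrite retrD retrZ retrH {1}/retr mxtrace1.
  have -> : complex.Re (dB%:R : C) = dB%:R
    by rewrite -(rmorph_nat (real_complex R)).
  by rewrite lerD2r hF.
move=> r hr; have hNr := density_channel hN hr; have [pNr _] := hNr.
apply: psd_of_unit => // [|v v1].
  have [hNr' _] := iffLR (psdP _) pNr.
  by rewrite adjmxB adjmxD hH hNr' adjmxZ conj_real_complex adjmx1.
rewrite mulmxBl mulmxDl -scalemxAl mul1mx retrB retrD retrZ {2}/retr v1 /= mulr1 rH.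
(* The guess [r] sits at [ord0], the index of the outcome added by [perturbed_povm]. *)
pose rho' (y : 'I_n.+1) := if unlift ord0 y is Some z then rho z else r.
have hrho' y : density (rho' y) by rewrite /rho'; case: unlift.
have e01 : 0 <= e <= 1 by rewrite ltW.
have := hF _ rho' _ hrho' (povm_perturbed e01 v1 hPi).
rewrite /guess big_ord_recl /perturbed_povm /rho' unlift_none.
under eq_bigr => y _ do rewrite liftK.
rewrite -scalemxAl retrZ (retrC (ketbra v)) => le_F.
have : guess rho Pi - e * 2 * retr (K *m ketbra v) <=
    \sum_y retr ((1%:M - e%:C *: ketbra v) *m Pi y *m
                 (1%:M - e%:C *: ketbra v) *m N (rho y)).
  rewrite /K mulmx_suml retr_sum mulr_sumr -sumrB; apply: ler_sum => y _.
  exact: retr_compress (pPi y) (psd_channel cp (hrho y).1).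
move: le_F near (density_unit_le1 hNr v1).
move: (retr (N r *m _)) (retr (K *m _)) (\sum_y _) (guess _ _) => p h s g.
move=> le_F near p1 le_s.
have p2 : e ^+ 2 * p <= e ^+ 2 by rewrite ler_piMr // sqr_ge0.
(* Combining [e (2 - e) p + s <= F], [g - 2 e h <= s] and [F - e^2 < g] gives
   [2 e (p - h) < e^2 + e^2 p <= 2 e^2]. Near-optimality to order [e^2] is what leaves a slack of
   only [e] after division. *)
have : e * (2 * (p - h)) < e * (2 * e) by lra.
rewrite ltr_pM2l //; lra.
Qed.
End Duality.

(** * Limits of bounded matrix sequences along an ultrafilter *)

Section Limit.
Local Open Scope classical_set_scope.

Variable R : realType.
Local Notation C := R[i].

(** Compactness of [[-B, B]] gives a cluster point, to which an ultrafilter must converge. A single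
    [U] then serves all matrix entries at once, without extracting subsequences. *)
Lemma ultra_cvg_bounded (U : set_system nat) (u : nat -> R) (B : R) :
  UltraFilter U -> (forall n, `|u n| <= B) ->
  exists l : R, u n @[n --> U] --> l.
Proof.
move=> ultraU uB; have [|l [_ hl]] := @segment_compact R (- B) B (u @ U) _.
  apply: (@filterS _ U _ setT) => [n _|]; last exact: filterT.
  by rewrite /= in_itv /= -ler_norml.
exists l => A nA.
have [//|UnA] := in_ultra_setVsetC (u @^-1` A) ultraU.
by have [x [/= nAx Ax]] := hl (~` A) A UnA nA.
Qed.

Lemma cvg_sum_seq (T J : Type) (F : set_system T) (FF : Filter F) (r : seq J)
  (f : J -> T -> R) (l : J -> R) :
  (forall j, f j x @[x --> F] --> l j) ->
  (\sum_(j <- r) f j x) @[x --> F] --> \sum_(j <- r) l j.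
Proof.
move=> fl; elim: r => [|j r ih].
  by rewrite big_nil; under eq_fun do rewrite big_nil; exact: cvg_cst.
by rewrite big_cons; under eq_fun do rewrite big_cons; exact: cvgD (fl j) ih.
Qed.

Lemma norm_ReIm_le (z : C) (B : R) : `|z| <= B%:C ->
  `|complex.Re z| <= B /\ `|complex.Im z| <= B.
Proof.
move=> zB; split; first by rewrite -lecR (le_trans (normc_ge_Re z)).
rewrite -normrN -ReiNIm -lecR (le_trans (normc_ge_Re _)) // normrM.
by rewrite complexiE normCi mulr1.
Qed.


(** Limits are taken separately in the real and imaginary parts of the entries. Convergence is
    stated for pairings, the form in which positivity and trace bounds pass to the limit. *)
Lemma ultra_limit_mx d (U : set_system nat) (Z : nat -> 'M[C]_d) (B : R) :
  UltraFilter U -> (forall n, psd (Z n)) -> (forall n, retr (Z n) <= B) ->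
  exists Y : 'M[C]_d, Y^t* = Y /\
    forall X, retr (Z n *m X) @[n --> U] --> retr (Y *m X).
Proof.
move=> ultraU pZ ZB; have PU := @ultra_proper _ _ ultraU.
have bound i j n : `|Z n i j| <= B%:C.
  apply: le_trans (norm_psd_entry_le_trace i j (pZ n)) _.
  have /psdP[hZ _] := pZ n; move: (trace_adjmx (Z n)) (ZB n); rewrite hZ /retr.
  case: (\tr _) => a b /= [] bE aB; rewrite lecE /= aB andbT; apply/eqP; lra.
have lims i j : exists z : C,
    complex.Re (Z n i j) @[n --> U] --> complex.Re z /\
    complex.Im (Z n i j) @[n --> U] --> complex.Im z.
  have [a ha] := ultra_cvg_bounded ultraU
    (fun n => (norm_ReIm_le (bound i j n)).1).
  have [b hb] := ultra_cvg_bounded ultraU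
    (fun n => (norm_ReIm_le (bound i j n)).2).
  by exists (a +i* b).
have rows i : exists g : 'I_d -> C, forall j,
    complex.Re (Z n i j) @[n --> U] --> complex.Re (g j) /\
    complex.Im (Z n i j) @[n --> U] --> complex.Im (g j).
  by have [g hg] := boolp.choice (lims i); exists g.
have [f hf] := boolp.choice rows.
exists (\matrix_(i, j) f i j); split.
  apply/matrixP => i j; rewrite !mxE.
  have [re_ij im_ij] := hf i j; have [re_ji im_ji] := hf j i.
  have Zconj n : Z n j i = Num.conj (Z n i j).
    by have /psdP[hZ _] := pZ n; rewrite -{1}hZ !mxE.
  have e1 : complex.Re (f j i) = complex.Re (f i j).
    apply: (cvg_unique (@norm_hausdorff _ _) re_ji).
    suff -> : (fun n => complex.Re (Z n j i)) =
              (fun n => complex.Re (Z n i j)) by [].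
    by apply/funext => n; rewrite Zconj complex_Re_conj.
  have e2 : complex.Im (f j i) = - complex.Im (f i j).
    apply: (cvg_unique (@norm_hausdorff _ _) im_ji).
    have -> : (fun n => complex.Im (Z n j i)) =
              (fun n => - complex.Im (Z n i j)).
      by apply/funext => n; rewrite Zconj; case: (Z n i j).
    exact: cvgN im_ij.
  move: e1 e2; case: (f i j) (f j i) => [a b] [c e] /= -> ->.
  by rewrite -[LHS]/(a -i* (- b)) opprK.
move=> X.
have Re0 : complex.Re (0 : C) = 0 by [].
have retrE (M : 'M[C]_d) : retr (M *m X) = \sum_i \sum_j
    (complex.Re (M i j) * complex.Re (X j i) -
     complex.Im (M i j) * complex.Im (X j i)).
  rewrite /retr /mxtrace (big_morph _ (@complex_ReD R) Re0); apply: eq_bigr => i _.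
  rewrite mxE (big_morph _ (@complex_ReD R) Re0); apply: eq_bigr => j _.
  by case: (M i j) (X j i) => [a b] [c e].
have -> : (fun n => retr (Z n *m X)) = fun n => \sum_i \sum_j
    (complex.Re (Z n i j) * complex.Re (X j i) -
     complex.Im (Z n i j) * complex.Im (X j i)).
  by apply/funext => n; exact: retrE.
rewrite retrE; apply: cvg_sum_seq => i; apply: cvg_sum_seq => j.
have [hr hi] := hf i j; rewrite mxE.
by apply: cvgB; apply: cvgMl.
Qed.
End Limit.

(** * Attainment of the optimum and passage to the separable dual cone *)

Section Optimum.
Local Open Scope classical_set_scope.

Variables (R : realType) (dA dB : nat).
Local Notation C := R[i].
Hypotheses (hA : (0 < dA)%N) (hB : (0 < dB)%N).

Variable N : {linear 'M[C]_dA -> 'M[C]_dB}.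
Hypothesis hN : quantum_channel N.

Lemma dominates_limit (F : R) :
  (forall e, 0 < e <= 1 -> exists Z, dominates N Z /\ retr Z <= F + e * dB%:R) ->
  exists Z, dominates N Z /\ retr Z <= F.
Proof.
move=> hF.
(* [harmonic n] is [1 / (n + 1)], which lies in [(0, 1]] already at [n = 0]. *)
have hZ n : exists Z, dominates N Z /\ retr Z <= F + harmonic n * dB%:R.
  by apply: hF; rewrite harmonic_gt0 /= invf_le1 ?ltr0n // ler1n.
have {hZ} [Z hZ] := boolp.choice hZ.
(* [U] refines the filter at infinity, so [harmonic] still tends to 0 along it. *)
have [U [ultraU leU]] := @ultraFilterLemma nat \oo _.
have PU := @ultra_proper _ _ ultraU.
have ZB n : retr (Z n) <= F + dB%:R.
  apply: le_trans (hZ n).2 _; rewrite lerD2l ler_piMl //.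
  by rewrite /= invf_le1 ?ltr0n // ler1n.
have [Y [hY cvgY]] :=
  ultra_limit_mx ultraU (fun n => dominates_psd hA hN (hZ n).1) ZB.
exists Y; split => [rho hrho|].
  have [/psdP[hNr _] _] := density_channel hN hrho.
  apply/psdP; split=> [|v]; first by rewrite adjmxB hY hNr.
  rewrite mulmxBl retrB subr_ge0; apply: cvgr_to_ge (cvgY (ketbra v)) _.
  apply: nearW => n; have /psdP[_ /(_ v)] := (hZ n).1 _ hrho.
  by rewrite mulmxBl retrB subr_ge0.
have cvgF : F + harmonic n * dB%:R @[n --> U] --> F + 0 * dB%:R.
  apply: cvgD; first exact: cvg_cst.
  by apply: cvgMl; apply: cvg_trans cvg_harmonic; exact: cvg_app.
rewrite mul0r addr0 in cvgF.
rewrite -[Y]mulmx1; apply: ler_cvg_to (cvgY 1%:M) cvgF _.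
by apply: nearW => n; rewrite mulmx1; exact: (hZ n).2.
Qed.

(** The one-outcome measurement gives the lower bound; the upper one holds since the identity
    dominates every state. Hence [cv N] is finite and positive and has a logarithm. *)
Lemma cv_bounds : (1%:E <= cv N <= dB%:R%:E)%E.
Proof.
apply/andP; split.
  have [rho hrho] := density_exists R hA.
  have [_ tNr] := density_channel hN hrho.
  have povm1 : povm (fun _ : 'I_1 => 1%:M : 'M[C]_dB).
    by split=> [_|]; [exact: psd1|rewrite big_ord1].
  have := guess_le_cv hB N (fun _ : 'I_1 => hrho) povm1.
  by rewrite /guess big_ord1 mul1mx /retr tNr.
have dom1 : dominates N 1%:M.
  by move=> rho hrho; apply: density_le1 => //; exact: density_channel.
have := cv_le_dominates hA hN dom1; rewrite /retr mxtrace1.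
by rewrite -(rmorph_nat (real_complex R)).
Qed.

Lemma cv_attained : exists (F : R) Z,
  [/\ cv N = F%:E, 0 < F, dominates N Z & retr Z = F].
Proof.
have [cv1 cvd] := andP cv_bounds.
have cv_fin : cv N \is a fin_num.
  rewrite fin_numE; apply/andP.
  by split; apply/eqP => cvE; move: cv1 cvd; rewrite cvE.
move: (fineK cv_fin); set F := fine (cv N) => FE.
have F0 : 0 < F by rewrite -lte_fin FE; apply: lt_le_trans cv1; rewrite lte_fin.
have [|Z [domZ leZ]] := @dominates_limit F.
  move=> e e01; have [e0 _] := andP e01.
  have e2 : 0 < e ^+ 2 by rewrite exprn_gt0.
  have [_ [n [n' [rho [Pi [n0 hrho hPi ->]]]]]] :=
    ub_ereal_sup_adherent e2 cv_fin.
  rewrite -/(cv N) -FE -EFinB lte_fin.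
  have [rho' [hrho' ->]] := classical_cv_guess hN n0 hrho hPi.
  apply: (near_optimal_dominates hB hN) => // m r P hr hP.
  by rewrite -lee_fin FE; exact: guess_le_cv.
exists F, Z; split=> //; apply/eqP; rewrite eq_le leZ -lee_fin FE /=.
exact: cv_le_dominates.
Qed.

Lemma trace_tens1_sub_choi (Z : 'M[C]_dB) (a : 'cV[C]_dA) (b : 'cV[C]_dB) :
  \tr (((1%:M : 'M[C]_dA) *t Z - choi N) *m (ketbra a *t ketbra b)) =
  \tr (ketbra a) * \tr (Z *m ketbra b)
  - \tr (N (ketbra (map_mx Num.conj a)) *m ketbra b).
Proof.
rewrite mulmxBl raddfB /= trace_choi_ketbra; congr (_ - _).
by rewrite tensmx_mul trace_tens mul1mx.
Qed.

Lemma dominates_SEP_dual Z :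
  dominates N Z -> SEP_dual ((1%:M : 'M[C]_dA) *t Z - choi N).
Proof.
move=> domZ; have /psdP[hZ _] := dominates_psd hA hN domZ.
have [cp _] := hN; have /psdP[hJ _] := psd_choi cp.
have hW : ((1%:M : 'M[C]_dA) *t Z - choi N)^t* =
  (1%:M : 'M[C]_dA) *t Z - choi N.
  by rewrite adjmxB hJ trmx_tens map_mxT adjmx1 hZ.
split; first exact/hermsymmxP.
move=> _ [k [t [al [be [t0 ->]]]]]; rewrite mulmx_sumr trace_sum.
apply: sumr_ge0 => i _; rewrite -scalemxAr mxtraceZ; apply: mulr_ge0.
  by rewrite ler0c.
(* Normalising the conjugated vector makes it a pure state, to which domination applies; conjugation
   leaves the norm unchanged. *)
have [u [s [u1 s0 uE]]] := ketbra_unit (map_mx Num.conj (al i)) hA.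
have tE : \tr (ketbra (al i)) = s%:C.
  by rewrite -mxtrace_tr -ketbra_conj uE mxtraceZ u1 mulr1.
rewrite trace_tens1_sub_choi tE uE linearZ /= -scalemxAl mxtraceZ -mulrBr.
rewrite -raddfB /= -mulmxBl; apply: mulr_ge0; first by rewrite ler0c.
have /psdP[hZN /(_ (be i))] := domZ _ (density_ketbra u1).
by rewrite trace_ketbra_real // ler0c.
Qed.

(** Decompose [rho] into dyads and test on the product of each conjugated dyad with [ketbra w]; as
    [rho] has trace one, the contributions of [Z] add up to a single copy. *)
Lemma SEP_dual_dominates Z : Z^t* = Z ->
  SEP_dual ((1%:M : 'M[C]_dA) *t Z - choi N) -> dominates N Z.
Proof.
move=> hZ [_ hW] rho [prho trho].
have [cp _] := hN; have /psdP[hNr _] := psd_channel cp prho.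
apply/psdP; split=> [|w]; first by rewrite adjmxB hZ hNr.
have [v vE] := psd_sum_ketbra prho.
have -> : retr ((Z - N rho) *m ketbra w) = \sum_i complex.Re
  (\tr (ketbra (v i)) * \tr (Z *m ketbra w) -
   \tr (N (ketbra (v i)) *m ketbra w)).
  rewrite -(big_morph _ (@complex_ReD R) (erefl : complex.Re (0 : C) = 0)).
  rewrite sumrB -mulr_suml.
  rewrite -!trace_sum -mulmx_suml -linear_sum /= -vE trho mul1r.
  by rewrite -raddfB -mulmxBl.
apply: sumr_ge0 => i _; apply: complex_Re_ge0.
have vv : map_mx Num.conj (map_mx Num.conj (v i)) = v i.
  by apply/matrixP => j k; rewrite !mxE conjCK.
have := hW (ketbra (map_mx Num.conj (v i)) *t ketbra w) _.
rewrite trace_tens1_sub_choi vv ketbra_conj mxtrace_tr; apply.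
exists 1%N, (fun=> 1), (fun=> map_mx Num.conj (v i)), (fun=> w).
split=> [_|]; first exact: ler01.
by rewrite big_ord1 rmorph1 scale1r ketbra_conj.
Qed.
End Optimum.

(** * Base-two logarithms and the final identity *)

Lemma scale_tensmx (K : comPzRingType) m n p q (c : K) (A : 'M[K]_(m, n))
    (B : 'M[K]_(p, q)) :
  c *: (A *t B) = A *t (c *: B).
Proof. by apply/matrixP => i j; rewrite !mxE mulrCA. Qed.

Lemma powR_log2 (R : realType) (x : R) : 0 < x -> 2 `^ (ln x / ln 2) = x.
Proof.
move=> x0; rewrite /powR pnatr_eq0 /= divfK ?lnK ?posrE //.
by rewrite gt_eqF // ln_gt0 // ltr1n.
Qed.

(* The second conjunct records that the minima in the definition of the
   separable min-entropy exist. *)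
Theorem mainTheorem2 (R : realType) (dA dB : nat)
    (hA : (0 < dA)%N) (hB : (0 < dB)%N)
    (N : {linear 'M[R[i]]_dA -> 'M[R[i]]_dB}) (hN : quantum_channel N) :
  cv N = pow2e (- Hsep_min (choi N))%E /\ Hsep_min_attained (choi N).
Proof.
have [F [Z [cvE F0 domZ trZ]]] := cv_attained hA hB hN.
have pZ := dominates_psd hA hN domZ.
pose lam := ln F / ln 2.
have lamE : 2 `^ lam = F by exact: powR_log2.
(* The optimal [Z] has trace [F = 2 ^ lam], so dividing by it leaves a state. *)
pose sigma := (F^-1)%:C *: Z.
have sigmaE : (2 `^ lam)%:C *: sigma = Z.
  by rewrite scalerA -rmorphM lamE mulfV ?gt_eqF // scale1r.
have hsigma : density sigma.
  split; first by apply: psdZ pZ; rewrite invr_ge0 ltW.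
  have trZ' : \tr Z = F%:C.
    have /psdP[hZ _] := pZ; move: (trace_adjmx Z) trZ; rewrite hZ /retr.
    by case: (\tr Z) => a b /= [] bE ->; congr Complex; lra.
  by rewrite mxtraceZ trZ' -rmorphM mulVf ?gt_eqF.
have feas : le_SEP_dual (choi N) ((2 `^ lam)%:C *: ((1%:M : 'M_dA) *t sigma)).
  by rewrite /le_SEP_dual scale_tensmx sigmaE; exact: dominates_SEP_dual.
(* Any feasible pair yields a dominating operator of trace [2 ^ l], so weak duality gives
   [F <= 2 ^ l]. *)
have lower s l : density s ->
    le_SEP_dual (choi N) ((2 `^ l)%:C *: ((1%:M : 'M_dA) *t s)) -> lam <= l.
  move=> [ps ts]; rewrite /le_SEP_dual scale_tensmx => hs.
  have /psdP[hs' _] := ps.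
  have dom : dominates N ((2 `^ l)%:C *: s).
    by apply: (SEP_dual_dominates hN) hs; rewrite adjmxZ conj_real_complex hs'.
  have := cv_le_dominates hA hN dom.
  rewrite cvE lee_fin retrZ /retr ts mulr1 => leF.
  have ln2 : 0 < ln (2 : R) by rewrite ln_gt0 // ltr1n.
  rewrite /lam ler_pdivrMr // -ln_powR ler_ln ?posrE //.
have HE : Hsep_min (choi N) = (- lam%:E)%E.
  congr (- _)%E; apply/eqP; rewrite eq_le; apply/andP; split.
    apply: ge_ereal_inf; exists (Dsep_max (choi N) ((1%:M : 'M_dA) *t sigma)).
      by exists sigma.
    by apply: ge_ereal_inf; exists lam%:E => //; exists lam.
  apply/ereal_infP => _ [s hs <-]; apply/ereal_infP => _ [l hl <-].
  by rewrite lee_fin; exact: lower hl.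
split; last by exists sigma, lam.
by rewrite HE oppeK cvE /= lamE.
Qed.
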